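(* Let $\alpha,\beta$ be real numbers with $0\le\alpha\le\beta$ and $\beta>0$. For every $n\in\mathbb{N}$, the nodes $\frac{k+\alpha}{n+\beta}$ ($k=0,1,\ldots,n$) are more closely clustered around $\frac{\alpha}{\beta}$ than the nodes $\frac{k}{n}$ ($k=0,1,\ldots,n$); that is, for every $k\in\{0,1,\ldots,n\}$, $$\left|\frac{k+\alpha}{n+\beta}-\frac{\alpha}{\beta}\right|\le\left|\frac{k}{n}-\frac{\alpha}{\beta}\right|.$$
   Context: $\mathbb{N}=\{1,2,3,\ldots\}$. For fixed $n$, the points $\frac{k}{n}$ are the nodes of the Bernstein operator of degree $n$ and the points $\frac{k+\alpha}{n+\beta}$ are the nodes of the Bernstein-Stancu operator of degree $n$ with parameters $\alpha,\beta$. *)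

(* Defs.v *)
From Stdlib Require Import Reals.
Open Scope R_scope.

Definition bernstein_node (n k : nat) : R := INR k / INR n.

Definition stancu_node (alpha beta : R) (n k : nat) : R :=
  (INR k + alpha) / (INR n + beta).

(* Main.v *)
(** The difference [(k + alpha) / (n + beta) - alpha / beta] is
    [k / n - alpha / beta] scaled by the factor [n / (n + beta)], which lies
    in [[0, 1]]. *)

Require Import Defs.
From Stdlib Require Import Reals Lra.
Open Scope R_scope.

(** The affine map [x -> (n x + alpha) / (n + beta)] sends each Bernstein node to the Stancu node of
    the same index and fixes [alpha / beta]. Its slope [n / (n + beta)] is less than 1, so it
    contracts towards that point; [stancu_node_sub] is this map centred at its fixed point. *)

Lemma stancu_node_sub (alpha beta : R) (n k : nat) :
  0 < beta -> 0 < INR n ->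
  stancu_node alpha beta n k - alpha / beta
  = INR n / (INR n + beta) * (bernstein_node n k - alpha / beta).
Proof.
  intros Hbeta Hn. unfold stancu_node, bernstein_node.
  field. repeat split; lra.
Qed.

Theorem theorem2 (alpha beta : R)
  (Halpha : 0 <= alpha) (Halphabeta : alpha <= beta) (Hbeta : 0 < beta)
  (n : nat) (Hn : (1 <= n)%nat) (k : nat) (Hk : (k <= n)%nat) :
  Rabs (stancu_node alpha beta n k - alpha / beta)
  <= Rabs (bernstein_node n k - alpha / beta).
Proof.
  assert (Hpos : 0 < INR n) by now apply lt_0_INR.
  rewrite stancu_node_sub, Rabs_mult by assumption.
  (* A factor 1 on the right-hand side reduces the claim to comparing the slope with 1. *)
  rewrite <- (Rmult_1_l (Rabs (bernstein_node n k - alpha / beta))) at 2.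
  apply Rmult_le_compat_r; [apply Rabs_pos |].
  rewrite Rabs_pos_eq.
  - apply Rmult_le_reg_r with (INR n + beta); [lra |].
    unfold Rdiv; rewrite Rmult_assoc, Rinv_l; lra.
  - apply Rle_mult_inv_pos; lra.
Qed.
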